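(* Let $R$ be a nonzero unit-additive ring. If $\operatorname{char}(R)>0$, then $\operatorname{char}(R)$ is a power of a prime number.
   Context: All rings are commutative and unital. A ring $R$ is unit-additive if whenever $u,v$ are units of $R$, $u+v$ is either a unit of $R$ or a nilpotent element. *)

(* Defs.v *)
From mathcomp Require Import all_boot all_order all_algebra.

Set Implicit Arguments.
Unset Strict Implicit.
Unset Printing Implicit Defensive.

Import GRing.Theory.
Local Open Scope ring_scope.

(* [GRing.unit] is only available on rings equipped with a decidable unit
   predicate and an inverse operation; invertibility is stated here as a
   proposition so that no such structure is required of the ring. *)
Definition is_unit (R : comPzRingType) (u : R) : Prop := exists v : R, u * v = 1.

Definition is_nilpotent (R : comPzRingType) (x : R) : Prop :=
  exists k : nat, x ^+ k = 0.

Definition unit_additive (R : comPzRingType) : Prop :=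
  forall u v : R, is_unit u -> is_unit v ->
    is_unit (u + v) \/ is_nilpotent (u + v).

(* [n] is the nonnegative generator of the kernel of the ring morphism from the
   integers to [R]; in particular [n] is 0 when this morphism is injective.
   ([pchar R] is not used: it is the set of primes vanishing in [R], which does
   not determine the characteristic of a ring that is not a domain.) *)
Definition has_char (R : comPzRingType) (n : nat) : Prop :=
  forall k : int, k%:~R = 0 :> R <-> (n%:Z %| k)%Z.

(* Main.v *)
(* In a unit-additive ring every natural number is a unit or nilpotent, by
   induction: adding 1 to a unit is covered by the hypothesis, and adding 1 to
   a nilpotent gives a unit. A prime p dividing the characteristic n > 0 is a
   zero divisor, hence nilpotent, so n divides a power of p. *)
Require Import Defs.
From mathcomp Require Import all_boot all_order all_algebra.

Import GRing.Theory.

(** With [y = - x] nilpotent, [1 - y] is inverted by the finite geometric series in [y]. *)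
Lemma is_unit_nilpotentD1 (R : comPzRingType) (x : R) :
  is_nilpotent x -> is_unit (x + 1)%R.
Proof.
move=> [k xk0]; exists (\sum_(i < k) (- x) ^+ i)%R.
(* Negation turns [x + 1] into [- x - 1], the factor [y - 1] of [y ^+ k - 1]. *)
apply: oppr_inj; rewrite -mulNr opprD -subrX1.
by rewrite exprNn xk0 mulr0 sub0r.
Qed.

Lemma natr_unit_or_nilpotent (R : comPzRingType) (m : nat) :
  unit_additive R -> is_unit (m%:R : R)%R \/ is_nilpotent (m%:R : R)%R.
Proof.
move=> uaR; elim: m => [|m IHm]; first by right; exists 1; rewrite expr1.
rewrite -natr1; case: IHm => [m_unit | m_nil].
  by apply: uaR => //; exists 1%R; rewrite mulr1.
by left; apply: is_unit_nilpotentD1.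
Qed.

Lemma has_char_natr_eq0 (R : comPzRingType) (n m : nat) :
  has_char R n -> (m%:R = 0 :> R)%R <-> n %| m.
Proof. by move=> R_char; exact: (R_char (Posz m)). Qed.

(** Characteristic 1 would force [1 = 0] in [R]; excluding it ensures that a positive [n] has a
    prime divisor. *)
Lemma has_char_neq1 (R : comNzRingType) (n : nat) : has_char R n -> n != 1.
Proof.
move=> /has_char_natr_eq0 R_char; apply/eqP => n1.
have /R_char/eqP : n %| 1 by rewrite n1.
by rewrite oner_eq0.
Qed.

(** If [d * v = 1] in [R], then [n %/ d] equals [(n %/ d) * d * v = n * v = 0] there, yet [n] cannot
    divide the smaller positive number [n %/ d]. *)
Lemma has_char_dvd_nonunit (R : comPzRingType) (n d : nat) :
  has_char R n -> 0 < n -> 1 < d -> d %| n -> ~ is_unit (d%:R : R)%R.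
Proof.
move=> /has_char_natr_eq0 R_char n_gt0 d_gt1 d_dvd_n [v dv1].
have nd_gt0 : 0 < n %/ d by rewrite divn_gt0 ?(ltnW d_gt1) // dvdn_leq.
have : ((n %/ d)%:R = 0 :> R)%R.
  rewrite -[LHS]mulr1 -[X in (_ * X)%R]dv1 mulrA -natrM divnK //.
  by rewrite ((R_char n).2 (dvdnn n)) mul0r.
move/R_char => /(dvdn_leq nd_gt0).
by rewrite leqNgt ltn_Pdiv.
Qed.

Theorem corollary2p2 (R : comNzRingType) (n : nat)
  (R_unit_additive : unit_additive R) (R_char : has_char R n) (n_gt0 : 0 < n) :
  exists p k : nat, [/\ prime p, 0 < k & n = p ^ k].
Proof.
have n_gt1 : 1 < n by rewrite ltn_neqAle eq_sym (has_char_neq1 R).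
have p_prime := pdiv_prime n_gt1.
have p_gt1 := prime_gt1 p_prime.
case: (natr_unit_or_nilpotent R (pdiv n) R_unit_additive) => [p_unit | [k pk0]].
  by case: (has_char_dvd_nonunit R n _ R_char n_gt0 p_gt1 (pdiv_dvd n) p_unit).
move: pk0; rewrite -natrX.
move=> /(has_char_natr_eq0 R n _ R_char)/(dvdn_pfactor _ _ p_prime) [m _ n_eq].
exists (pdiv n), m; split=> //.
(* The exponent [m = 0] would give [n = 1]. *)
by move: n_gt1; rewrite {1}n_eq; case: m {n_eq}.
Qed.
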